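(* Let $\mathcal{A}$ be an addable minor-closed class of graphs whose set $\mathcal{H}$ of excluded minors is suitable. Then, as $n\to\infty$, $$\frac{\operatorname{gap}_{\mathcal{H}}(n)}{n}\to \operatorname{limp}(\mathcal{H}).$$
   Context: Graphs are finite and simple. A graph $G$ contains $H$ as a minor if a graph isomorphic to $H$ can be obtained from a subgraph of $G$ by edge contractions (discarding loops and multiple edges). A class of graphs is minor-closed if it contains every minor of each of its members. A graph $H$ is an excluded minor for a minor-closed class $\mathcal{A}$ if $H\notin\mathcal{A}$ but every minor of $H$ other than $H$ itself is in $\mathcal{A}$. A set $\mathcal{H}$ of graphs is suitable if it is non-empty and each graph in it has at least one edge. $G$ is $\mathcal{H}$-free if it has no minor in $\mathcal{H}$ (so $\mathcal{A}$ is the class of $\mathcal{H}$-free graphs when $\mathcal{H}$ is its set of excluded minors). An $\mathcal{H}$-free graph is edge-maximal $\mathcal{H}$-free if adding any edge between two non-adjacent vertices creates a graph that is not $\mathcal{H}$-free. For $n\ge1$ let $E_{\mathcal{H}}(n)=\{e(G): G\text{ is an edge-maximal }\mathcal{H}\text{-free graph on }n\text{ vertices}\}$, $\operatorname{gap}_{\mathcal{H}}(n)=\max E_{\mathcal{H}}(n)-\min E_{\mathcal{H}}(n)$, and $\operatorname{limp}(\mathcal{H})=\liminf_{n\to\infty}\operatorname{gap}_{\mathcal{H}}(n)/n$. A class $\mathcal{A}$ is addable if (1) $G\in\mathcal{A}$ if and only if every component of $G$ is in $\mathcal{A}$, and (2) whenever $G\in\mathcal{A}$ and $u,v$ are in different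 components of $G$, the graph obtained from $G$ by adding the edge $\{u,v\}$ is in $\mathcal{A}$. *)

(* Defs.v *)
(* Finite graphs are set up over MathComp; the asymptotics use
   MathComp-Analysis. *)
From HB Require Import structures.
From mathcomp Require Import all_boot all_order all_algebra.
From mathcomp Require Import all_classical all_reals all_analysis.

Set Implicit Arguments.
Unset Strict Implicit.
Unset Printing Implicit Defensive.

Import Order.TTheory GRing.Theory Num.Theory numFieldNormedType.Exports.

(* The graph with no vertices is allowed. *)
Record sgraph : Type := SGraph {
  vertex :> finType;
  adj : rel vertex;
  adj_sym : symmetric adj;
  adj_irr : irreflexive adj }.

Arguments adj {s}.

(* [set sgraph] is not used because it raises a universe inconsistency. *)
Definition gclass := sgraph -> Prop.

Definition edges (G : sgraph) : {set {set G}} :=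
  ([set [set p.1; p.2] | p in [set p : G * G | adj p.1 p.2]])%SET.

Definition iso (G H : sgraph) : Prop :=
  exists f : G -> H, bijective f /\ forall x y, adj (f x) (f y) = adj x y.

Section Operations.
Variable G : sgraph.

Section Subgraph.
Variables (V : {set G}) (F : {set {set G}}).

Definition sub_adj : rel {x : G | x \in V} :=
  fun x y => adj (val x) (val y) && (([set val x; val y])%SET \in F).

Fact sub_adj_sym : symmetric sub_adj.
Proof. by move=> x y; rewrite /sub_adj adj_sym finset.setUC. Qed.

Fact sub_adj_irr : irreflexive sub_adj.
Proof. by move=> x; rewrite /sub_adj adj_irr. Qed.

(* Every subgraph of G arises from a choice of V and F; members of F that are
   not edges of G inside V are ignored. *)
Definition subgraph : sgraph := SGraph sub_adj_sym sub_adj_irr.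
End Subgraph.

Definition induced_subgraph (V : {set G}) : sgraph := subgraph V (edges G).

Definition component (x : G) : sgraph :=
  induced_subgraph ([set y | connect adj x y])%SET.

Section Contract.
Variables u v : G.

(* When uv is contracted, u stands for the merged vertex and v disappears. *)
Definition contract_adj : rel {x : G | x != v} :=
  fun x y => (x != y) &&
    [|| adj (val x) (val y),
        (val x == u) && adj v (val y) |
        (val y == u) && adj v (val x)].

Fact contract_adj_sym : symmetric contract_adj.
Proof.
move=> x y; rewrite /contract_adj eq_sym adj_sym; congr (_ && (_ || _)).
by rewrite orbC.
Qed.

Fact contract_adj_irr : irreflexive contract_adj.
Proof. by move=> x; rewrite /contract_adj eqxx. Qed.

Definition contract : sgraph := SGraph contract_adj_sym contract_adj_irr.
End Contract.

Section AddEdge.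
Variables u v : G.

Definition add_edge_adj : rel G :=
  fun x y => adj x y ||
    (x != y) && ((x == u) && (y == v) || (x == v) && (y == u)).

Fact add_edge_adj_sym : symmetric add_edge_adj.
Proof.
move=> x y; rewrite /add_edge_adj adj_sym eq_sym; congr (_ || (_ && _)).
by rewrite orbC andbC; congr (_ || _); rewrite andbC.
Qed.

Fact add_edge_adj_irr : irreflexive add_edge_adj.
Proof. by move=> x; rewrite /add_edge_adj adj_irr eqxx. Qed.

Definition add_edge : sgraph := SGraph add_edge_adj_sym add_edge_adj_irr.
End AddEdge.

End Operations.

Inductive contracts_to : sgraph -> sgraph -> Prop :=
| contracts_refl (G : sgraph) : contracts_to G G
| contracts_step (G K : sgraph) (u v : G) :
    adj u v -> contracts_to (contract u v) K -> contracts_to G K.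

Definition minor (H G : sgraph) : Prop :=
  exists (V : {set G}) (F : {set {set G}}) (K : sgraph),
    contracts_to (subgraph V F) K /\ iso K H.

Definition minor_closed (A : gclass) : Prop :=
  forall G H : sgraph, A G -> minor H G -> A H.

(* "Other than H itself" is understood up to isomorphism, so this set is closed
   under isomorphism. *)
Definition excluded_minors (A : gclass) : gclass :=
  fun H => ~ A H /\ forall M : sgraph, minor M H -> ~ iso M H -> A M.

Definition suitable (Hs : gclass) : Prop :=
  (exists H, Hs H) /\ forall H, Hs H -> exists x y : H, adj x y.

Definition minor_free (Hs : gclass) (G : sgraph) : Prop :=
  forall H, Hs H -> ~ minor H G.

Definition edge_maximal (Hs : gclass) (G : sgraph) : Prop :=
  minor_free Hs G /\
  forall u v : G, u != v -> ~~ adj u v -> ~ minor_free Hs (add_edge u v).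

Definition addable (A : gclass) : Prop :=
  (forall G : sgraph, A G <-> forall x : G, A (component x)) /\
  (forall (G : sgraph) (u v : G),
     A G -> ~~ connect adj u v -> A (add_edge u v)).

Definition edge_counts (Hs : gclass) (n : nat) : set nat :=
  fun m => exists G : sgraph,
    [/\ #|G| = n, edge_maximal Hs G & #|edges G| = m].

(* The default value 0 is only used when there is no greatest (least) element. *)
Definition max_nat (E : set nat) : nat :=
  xget 0%N (fun m => E m /\ forall k, E k -> (k <= m)%N).

Definition min_nat (E : set nat) : nat :=
  xget 0%N (fun m => E m /\ forall k, E k -> (m <= k)%N).

Local Open Scope ring_scope.

Definition gap (R : realType) (Hs : gclass) (n : nat) : R :=
  (max_nat (edge_counts Hs n))%:R - (min_nat (edge_counts Hs n))%:R.

(* limn_inf is the real liminf: its value is only meaningful when the liminf is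
   finite. This holds for suitable Hs, since graphs with no minor in Hs have
   at most linearly many edges. *)
Definition limp (R : realType) (Hs : gclass) : R :=
  limn_inf (fun n : nat => gap R Hs n / n%:R).

(* Main.v *)
Require Import Defs.
From mathcomp Require Import all_boot all_order all_algebra.
From mathcomp Require Import all_classical all_reals all_analysis.
From mathcomp Require Import zify ring lra.
Import Order.TTheory GRing.Theory Num.Theory numFieldNormedType.Exports.

(** Let M(n) and m(n) be the largest and the least number of edges of an
    edge-maximal graph on n vertices. The point is that gap = M - m is
    superadditive up to a constant K:

      gap(n1) + gap(n2) - K <= gap(n1 + n2)    for n1, n2 >= 1,

    and that 0 <= gap(n) <= c n. Then gap(n)/n converges, by Fekete's argument
    ([superadditive_cvg]), and its limit is its lower limit.

    Both halves of the inequality come from one construction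
    ([edge_maximal_join]). Let G1 and G2 be edge-maximal, with vertices v1 and
    v2. As the class A is addable, it contains the disjoint union of G1 and G2
    with the edge v1v2 added; extend this to an edge-maximal graph G.

    - G contains G1 and G2, so e(G) >= e(G1) + e(G2). Taking G1 and G2 with
      the most edges gives M(n1 + n2) >= M(n1) + M(n2).
    - G has no new edge inside G1 or G2, since these are edge-maximal. It has
      few edges between them: if xy is an edge of G with x in G1, y in G2 and
      x != v1, then contracting the connected graph G2 into x shows that
      G1 + v1x is a minor of G, so v1x was already an edge of G1
      ([cross_edge_neighbour]); likewise for y and v2. So the edges between
      G1 and G2 join the closed neighbourhoods of v1 and v2, and there are at
      most (deg v1 + 1)(deg v2 + 1) of them. Taking G1 and G2 with the fewest
      edges, and v1, v2 of bounded degree, gives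
      m(n1 + n2) <= m(n1) + m(n2) + K.

    A vertex of bounded degree exists, and gap(n) <= c n, because graphs
    without a fixed clique minor have linearly many edges (Mader, here
    [dense_has_clique]).

    Minors are handled through models: disjoint connected branch sets in G,
    one for each vertex of H, with an edge of G between the branch sets of
    adjacent vertices. Models compose, and a model exists exactly when H is a
    minor ([minorP]). *)

Set Implicit Arguments.
Unset Strict Implicit.
Unset Printing Implicit Defensive.

(** * Models of minors *)
Definition inner {G H : sgraph} (phi : G -> option H) : rel G :=
  [rel x y | adj x y && (phi x == phi y)].

(** The branch set of h is the set of x with [phi x = Some h]; vertices sent to
    [None] are deleted. *)
Record is_model (H G : sgraph) (phi : G -> option H) : Prop := IsModel {
  branch_inhabited : forall h, exists x, phi x = Some h;
  branch_connected : forall x y h,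
    phi x = Some h -> phi y = Some h -> connect (inner phi) x y;
  branch_adj : forall h h', adj h h' ->
    exists x y, [/\ phi x = Some h, phi y = Some h' & adj x y] }.

Definition has_model (H G : sgraph) : Prop := exists phi, @is_model H G phi.

(** The branch sets of the composite are unions of branch sets of [phi]; such a
    union is connected because a path in a branch set of [psi] lifts step by
    step, each edge of M being realised by an edge of G. *)
Lemma has_model_trans (M G H : sgraph) :
  has_model M G -> has_model H M -> has_model H G.
Proof.
move=> [phi mphi] [psi mpsi]; pose chi x := obind psi (phi x).
have sub_inner : subrel (inner phi) (connect (inner chi)).
  move=> x y /andP[xy /eqP e]; apply: connect1.
  by rewrite /inner /= xy /chi e eqxx.
have conn_inner := connect_sub sub_inner.
have lift_path a b h : connect (inner psi) a b -> psi a = Some h ->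
  forall x y, phi x = Some a -> phi y = Some b -> connect (inner chi) x y.
  case/connectP=> p; elim: p a => [|c p IH] a /=.
    by move=> _ -> _ x y ex ey;
       exact: (conn_inner _ _ (branch_connected mphi ex ey)).
  case/andP=> /andP[ac /eqP eac] pth lst pa x y ex ey.
  have [x1 [y1 [ex1 ey1 xy1]]] := branch_adj mphi ac.
  have x_x1 := conn_inner _ _ (branch_connected mphi ex ex1).
  apply: (connect_trans x_x1); apply: (connect_trans (y := y1)).
    by apply: connect1; rewrite /inner /= xy1 /chi ex1 ey1 /= eac eqxx.
  by apply: (IH c pth lst) => //; rewrite -eac.
exists chi; split.
- move=> h; have [a ea] := branch_inhabited mpsi h.
  by have [x ex] := branch_inhabited mphi a; exists x; rewrite /chi ex.
- move=> x y h; rewrite /chi.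
  case ex: (phi x) => [a|] //= pa; case ey: (phi y) => [b|] //= pb.
  exact: (lift_path a b h (branch_connected mpsi pa pb) pa).
- move=> h h' hh'; have [a [b [pa pb ab]]] := branch_adj mpsi hh'.
  have [x [y [ex ey xy]]] := branch_adj mphi ab.
  by exists x, y; rewrite /chi ex ey.
Qed.

Lemma has_model_embedding (H G : sgraph) (f : H -> G) :
  injective f -> (forall x y, adj x y -> adj (f x) (f y)) -> has_model H G.
Proof.
move=> injf homf; exists (fun y => [pick h | f h == y]).
have phif h : [pick h' | f h' == f h] = Some h.
  by case: pickP => [h' /eqP/injf -> //|/(_ h)]; rewrite eqxx.
split.
- by move=> h; exists (f h).
- move=> x y h; case: pickP => // _ /eqP <- [->].
  by case: pickP => // _ /eqP <- [->].
- by move=> h h' hh'; exists (f h), (f h'); split; [| |exact: homf].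
Qed.

Lemma has_model_refl (G : sgraph) : has_model G G.
Proof. exact: (@has_model_embedding G G id). Qed.

Lemma has_model_iso (G H : sgraph) : iso G H -> has_model H G.
Proof.
case=> f [[g fK gK] fadj].
apply: (@has_model_embedding H G g); first exact: can_inj gK.
by move=> x y xy; rewrite -fadj !gK.
Qed.

Lemma has_model_subgraph (G : sgraph) V F : has_model (@subgraph G V F) G.
Proof.
apply: (@has_model_embedding (@subgraph G V F) G val); first exact: val_inj.
by move=> x y /andP[].
Qed.

(** The merged vertex u has branch set {u, v}, all others are singletons. *)
Lemma has_model_contract (G : sgraph) (u v : G) :
  adj u v -> has_model (Defs.contract u v) G.
Proof.
move=> uv; have uNv : u != v by apply: contraTneq uv => ->; rewrite adj_irr.
pose r x := if x == v then u else x.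
pose phi (x : G) : option (Defs.contract u v) := insub (r x).
have phiP x h : phi x = Some h <-> r x = val h.
  rewrite /phi; split; first by case: insubP => // k _ <- [<-].
  by move=> e; rewrite e valK.
have rval (h : Defs.contract u v) : r (val h) = val h.
  by rewrite /r; have /negbTE -> := valP h.
have rv : r v = u by rewrite /r eqxx.
have ru : r u = u by rewrite /r (negbTE uNv).
exists phi; split.
- by move=> h; exists (val h); apply/phiP.
- have ruv : phi u = phi v by rewrite /phi rv ru.
  move=> x y h /phiP ex /phiP ey; have : r x = r y by rewrite ex.
  rewrite /r; case: eqP => [->|_]; case: eqP => [->|_].
  + by rewrite connect0.
  + by move=> <-; apply: connect1; rewrite /inner /= adj_sym uv ruv eqxx.
  + by move=> ->; apply: connect1; rewrite /inner /= uv ruv eqxx.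
  + by move=> ->; rewrite connect0.
- move=> h h' /andP[_ /or3P[hh|/andP[/eqP hu hv]|/andP[/eqP hu hv]]].
  + by exists (val h), (val h'); split => //; apply/phiP.
  + exists v, (val h'); split => //; apply/phiP => //.
    by rewrite rv.
  + exists (val h), v; split; [exact/phiP| |by rewrite adj_sym].
    by apply/phiP; rewrite rv.
Qed.

Lemma has_model_contracts_to (G K : sgraph) :
  contracts_to G K -> has_model K G.
Proof.
elim=> [|{}G {}K u v uv _ IH]; first exact: has_model_refl.
exact: has_model_trans (has_model_contract uv) IH.
Qed.

Lemma minor_has_model (H G : sgraph) : minor H G -> has_model H G.
Proof.
case=> V [F [K [/has_model_contracts_to KG /has_model_iso HK]]].
apply: has_model_trans (has_model_subgraph _ _) _.
exact: has_model_trans KG HK.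
Qed.

(** A model that deletes neither vertices nor edges other than those inside
    the branch sets: exactly what a sequence of contractions produces. *)
Record is_quotient (H G : sgraph) (phi : G -> H) : Prop := IsQuotient {
  quotient_surj : forall h, exists x, phi x = h;
  quotient_connected : forall x y, phi x = phi y ->
    connect [rel a b | adj a b && (phi a == phi b)] x y;
  quotient_lift : forall h h', adj h h' ->
    exists x y, [/\ phi x = h, phi y = h' & adj x y];
  quotient_adj : forall x y, adj x y -> phi x != phi y ->
    adj (phi x) (phi y) }.

(** By induction on the number of vertices. If phi is not injective, a path
    joining two vertices with the same image begins with an edge uv inside a
    fibre; contracting it leaves a smaller graph with the same quotient. *)
Lemma quotient_contracts_to (H G : sgraph) (phi : G -> H) :
  is_quotient phi -> exists2 K, contracts_to G K & iso K H.
Proof.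
have [n] := ubnP #|G|; elim: n => // n IH in G phi *.
rewrite ltnS => leGn q; have [injphi|] := pselect (injective phi).
  exists G; first exact: contracts_refl.
  exists phi; split.
    have sphi : codom phi =i predT.
      move=> h; apply/codomP; have [x <-] := quotient_surj q h.
      by exists x.
    by apply: inj_card_bij => //; rewrite -(card_codom injphi) (eq_card sphi).
  move=> x y; apply/idP/idP; last first.
    move=> xy; apply: quotient_adj => //; apply: contraTneq xy => /injphi ->.
    by rewrite adj_irr.
  move=> /(quotient_lift q)[x' [y' [/injphi -> /injphi ->]]] //.
move=> ninj.
have [u [v [uv euv]]] : exists u v : G, adj u v /\ phi u = phi v.
  apply: contrapT => nuv; apply: ninj => x y exy.
  have /connectP[[|z p] /=] := quotient_connected q exy; first by move=> _ ->.
  move=> /andP[/andP[xz /eqP exz] _] _; case: nuv.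
  by exists x, z.
have uNv : u != v by apply: contraTneq uv => ->; rewrite adj_irr.
pose psi (x : Defs.contract u v) := phi (val x).
have ltG : (#|Defs.contract u v| < n)%N.
  apply: leq_trans leGn; rewrite card_sig.
  by apply: proper_card; apply/fintype.properP; split;
    [exact/fintype.subsetP | exists v; rewrite ?inE ?eqxx].
(* r is the contraction map: it sends v to u and fixes the other vertices. *)
pose r (x : G) : Defs.contract u v := insubd (exist _ u uNv) x.
have valr x : val (r x) = if x == v then u else x.
  by rewrite /r val_insubd; case: (x == v).
have phir x : psi (r x) = phi x.
  by rewrite /psi valr; case: eqP => [->|].
have rval (x : Defs.contract u v) : r (val x) = x by rewrite /r valKd.
have radj x y : adj x y -> r x = r y \/ adj (r x) (r y).
  move=> xy; case: (eqVneq (r x) (r y)) => [|ne]; [by left|right].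
  rewrite /adj /= /contract_adj ne /=; move: xy ne.
  rewrite -(inj_eq val_inj) !valr.
  case: (eqVneq x v) => [->|_]; case: (eqVneq y v) => [->|_] xy ne.
  - by rewrite eqxx in ne.
  - by rewrite eqxx xy /= orbT.
  - by rewrite eqxx (adj_sym v x) xy /= !orbT.
  - by rewrite xy.
have := IH (Defs.contract u v) psi ltG; case=> [|K cK iK]; last first.
  by exists K => //; exact: (contracts_step uv cK).
split.
- by move=> h; have [x <-] := quotient_surj q h; exists (r x).
- move=> x y /(quotient_connected q)/connectP[p].
  move=> pth lst; rewrite -(rval x) -(rval y) lst.
  elim: p (val x) pth {lst} => [|b p IHp] a /=; first by rewrite connect0.
  move=> /andP[/andP[ab /eqP eab] /IHp]; apply: connect_trans.
  have [->|rab] := radj _ _ ab; first by rewrite connect0.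
  by apply: connect1; apply/andP; split=> //; rewrite !phir eab.
- move=> h h' hh'; have [x [y [ex ey xy]]] := quotient_lift q hh'.
  exists (r x), (r y); rewrite !phir; split => //.
  have [e|//] := radj _ _ xy.
  by move: hh'; rewrite -ex -ey -!phir e adj_irr.
- rewrite /psi => x y /andP[_ /or3P[xy|/andP[/eqP eu vy]|/andP[/eqP eu vx]]].
  + exact: quotient_adj.
  + by rewrite eu euv => ?; exact: quotient_adj.
  + rewrite eu euv eq_sym adj_sym => ?; exact: quotient_adj.
Qed.

(** The subgraph to contract keeps the vertices of the branch sets, and the
    edges inside a branch set or between branch sets of adjacent vertices. Its
    quotient by the branch sets is H. *)
Lemma has_model_minor (H G : sgraph) : has_model H G -> minor H G.
Proof.
case=> phi mphi; pose V := [set x | phi x != None]%SET.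
pose ok x y := (phi x == phi y) ||
  (if phi x is Some h then if phi y is Some h' then adj h h' else false
   else false).
have okC x y : ok x y = ok y x.
  rewrite /ok eq_sym.
  by case: (phi x) (phi y) => [h|] [h'|] //; rewrite adj_sym.
(* [set x; y] is in F iff ok x y, because ok is reflexive and symmetric. *)
pose F := [set E : {set G} | [forall x in E, forall y in E, ok x y]]%SET.
have FP x y : ([set x; y]%SET \in F) = ok x y.
  rewrite inE; apply/forall_inP/idP => [h|oxy a].
    by have /forall_inP := h x (set21 _ _); apply; exact: set22.
  have okxx z : ok z z by rewrite /ok eqxx.
  by rewrite !inE => /orP[]/eqP ->; apply/forall_inP => b;
    rewrite !inE => /orP[]/eqP -> //; rewrite okC.
have defined (x : subgraph V F) : {h | phi (val x) = Some h}.
  by case: x => x /=; rewrite inE; case: (phi x) => [h _|//]; exists h.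
pose psi x := sval (defined x).
have psiP x : phi (val x) = Some (psi x) by rewrite /psi; case: (defined x).
have psiE x h : phi (val x) = Some h -> psi x = h by rewrite psiP => -[].
have Vx x h : phi x = Some h -> x \in V by rewrite inE => ->.
have adjE (x y : subgraph V F) :
    adj x y = adj (val x) (val y) && ((psi x == psi y) || adj (psi x) (psi y)).
  by rewrite [LHS]/(sub_adj F x y) FP /ok !psiP.
have := @quotient_contracts_to H (subgraph V F) psi; case; last first.
  by move=> K cK iK; exists V, F, K.
split.
- move=> h; have [x ex] := branch_inhabited mphi h.
  by exists (exist _ x (Vx x h ex)); apply: psiE.
- move=> x y exy; have ex := psiP x; have ey := psiP y; rewrite -exy in ey.
  have /connectP[p] := branch_connected mphi ex ey.
  elim: p x ex {ey exy} => [|b p IH] x ex /=.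
    by move=> _ /val_inj ->; rewrite connect0.
  case/andP=> /andP[xb /eqP exb] pth lst.
  have eb : phi b = Some (psi x) by rewrite -exb.
  pose b' : subgraph V F := exist _ b (Vx b _ eb).
  have eb' : psi b' = psi x by apply: psiE.
  apply: (connect_trans (y := b')).
    have xb' : adj x b' && (psi x == psi b') by rewrite adjE eb' eqxx xb.
    exact: connect1.
  by apply: IH => //; rewrite eb'.
- move=> h h' hh'; have [x [y [ex ey xy]]] := branch_adj mphi hh'.
  pose x' : subgraph V F := exist _ x (Vx x _ ex).
  pose y' : subgraph V F := exist _ y (Vx y _ ey).
  have ex' : psi x' = h by apply: psiE.
  have ey' : psi y' = h' by apply: psiE.
  by exists x', y'; rewrite adjE ex' ey' hh' orbT andbT.
- by move=> x y; rewrite adjE => /andP[_ /orP[->|]].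
Qed.

Lemma minorP (H G : sgraph) : minor H G <-> has_model H G.
Proof. by split; [exact: minor_has_model | exact: has_model_minor]. Qed.
(** * Excluded minors *)

(** Twice the number of edges, see [arcsE]. Ordered pairs make double
    counting easier. *)
Definition arcs (G : sgraph) : nat := (\sum_(x : G) \sum_(y : G) adj x y)%N.

Lemma arcs_le_of_hom (M H : sgraph) (f : M -> H) :
  bijective f -> (forall x y, adj x y -> adj (f x) (f y)) ->
  (arcs M <= arcs H)%N /\
  (arcs M = arcs H -> forall x y, adj (f x) (f y) = adj x y).
Proof.
move=> bijf homf.
have -> : arcs H = (\sum_x \sum_y adj (f x) (f y))%N.
  rewrite /arcs (reindex f) /=; last exact: onW_bij.
  by apply: eq_bigr => x _; rewrite (reindex f) //; exact: onW_bij.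
rewrite /arcs !pair_bigA /=.
have /leqif_sum le (p : M * M) : true -> ((adj p.1 p.2 : nat)
    <= (adj (f p.1) (f p.2) : nat)
    ?= iff (adj p.1 p.2 == adj (f p.1) (f p.2)))%N.
  move=> _; have := homf p.1 p.2.
  by case: (adj p.1 p.2) => [/(_ isT) ->|_] //; case: adj.
split; first by rewrite le.
move=> /eqP; rewrite le => /forallP e.
by move=> x y; rewrite (eqP (e (x, y))).
Qed.

Lemma arcs_le_sq (G : sgraph) : (arcs G <= #|G| ^ 2)%N.
Proof.
rewrite /arcs -mulnn -sum_nat_const; apply: leq_sum => x _.
by rewrite -sum1_card; apply: leq_sum => y _; case: adj.
Qed.

(** A proper minor may have fewer vertices, or as many vertices and fewer edges.
    The cube makes the first case decisive: n^3 + n^2 < (n + 1)^3. *)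
Definition size_measure (G : sgraph) : nat := (#|G| ^ 3 + arcs G)%N.

(** Choosing a vertex in each branch set gives an injection of M into H. If it
    is a bijection, the branch sets are singletons and M is a spanning
    subgraph of H. *)
Lemma has_model_size (M H : sgraph) : has_model M H -> ~ iso M H ->
  (size_measure M < size_measure H)%N.
Proof.
case=> phi mphi niso.
have [f fP] := @choice _ _ _ (branch_inhabited mphi).
have injf : injective f by move=> x y e; have := fP x; rewrite e fP => -[].
rewrite /size_measure.
have := leq_card f injf; rewrite leq_eqVlt => /orP[/eqP eMH|ltMH].
  have bijf : bijective f by apply: inj_card_bij => //; rewrite eMH.
  have fE x h : phi x = Some h -> x = f h.
    by case: bijf => g _ gK; rewrite -(gK x) fP => -[->].
  have [|le eq] := @arcs_le_of_hom M H f bijf.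
    move=> h h' /(branch_adj mphi)[x [y [/fE -> /fE -> //]]].
  rewrite eMH ltn_add2l ltn_neqAle le andbT; apply/eqP => /eq adjf.
  by apply: niso; exists f.
have := arcs_le_sq M; rewrite !expnS !expn0 !muln1.
have := leq_mul ltMH (leq_mul ltMH ltMH); nia.
Qed.

(** A minimal minor of G outside A is an excluded minor. *)
Lemma exists_excluded (A : gclass) (G : sgraph) :
  ~ A G -> exists2 H, excluded_minors A H & has_model H G.
Proof.
have [n] := ubnP (size_measure G); elim: n => // n IH in G *.
rewrite ltnS => leGn nAG.
have [exG|nexG] := pselect (excluded_minors A G).
  by exists G => //; exact: has_model_refl.
have [M [/minorP MG niso nAM]] :
    exists M, [/\ minor M G, ~ iso M G & ~ A M].
  apply: contrapT => none; apply: nexG; split => // M MG niso.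
  by apply: contrapT => nAM; apply: none; exists M.
have [|H exH HM] := IH M _ nAM.
  by apply: leq_trans leGn; exact: has_model_size.
by exists H => //; exact: has_model_trans MG HM.
Qed.

Lemma minor_closed_model (A : gclass) (G H : sgraph) :
  minor_closed A -> has_model H G -> A G -> A H.
Proof. by move=> cA /minorP HG AG; exact: cA AG HG. Qed.

Lemma excluded_freeP (A : gclass) (G : sgraph) : minor_closed A ->
  minor_free (excluded_minors A) G <-> A G.
Proof.
move=> cA; split=> [free|AG H [nAH _] /(cA _ _ AG)//].
apply: contrapT => /exists_excluded[H exH /minorP HG]; exact: free H exH HG.
Qed.

(** * Linearly many edges *)
Definition deg (G : sgraph) (x : G) : nat := (\sum_(y : G) adj x y)%N.

Definition codeg (G : sgraph) (x y : G) : nat :=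
  (\sum_(z : G) (adj x z && adj y z))%N.

Lemma arcs_induced (G : sgraph) (N : {set G}) :
  arcs (induced_subgraph N) =
  (\sum_(x in N) \sum_(y in N) adj x y)%N.
Proof.
rewrite /arcs [RHS]big_sub; apply: eq_bigr => x _; rewrite [RHS]big_sub.
apply: eq_bigr => y _; congr (nat_of_bool _).
rewrite [LHS]/(sub_adj (edges G) x y); case xy: adj => //=.
by apply/imsetP; exists (val x, val y); rewrite ?inE.
Qed.

Lemma sum_sig (T : finType) (P : pred T) (F : T -> nat) :
  (\sum_(x | P x) F x = \sum_(x : {x | P x}) F (val x))%N.
Proof.
rewrite (reindex_omap (val : {x | P x} -> T) insub) /=.
  by apply: eq_bigl => -[x Px] /=; rewrite Px insubT eqxx.
by move=> x Px; rewrite insubT.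
Qed.

(** Contracting uv destroys the edge uv and merges the edges from u and v to
    each common neighbour; every other edge survives. *)
Lemma arcs_contract (G : sgraph) (u v : G) : adj u v ->
  (arcs G <= arcs (Defs.contract u v) + 2 + 2 * codeg u v)%N.
Proof.
move=> uv; have uNv : u != v by apply: contraTneq uv => ->; rewrite adj_irr.
(* b marks the neighbours of v that become new neighbours of u. *)
pose b y := [&& adj v y, y != u & ~~ adj u y].
pose B := (\sum_(y | y != v) b y)%N.
have -> : arcs (Defs.contract u v) = (\sum_(x | x != v) \sum_(y | y != v)
    ((x != y) && [|| adj x y, (x == u) && adj v y | (y == u) && adj v x]))%N.
  by rewrite /arcs [RHS]sum_sig; apply: eq_bigr => x _; rewrite [RHS]sum_sig.
have -> : arcs G =
   (\sum_(x | x != v) \sum_(y | y != v) adj x y + 2 * deg v)%N.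
  rewrite /arcs (bigD1 v) //=.
  have -> : (\sum_(x | x != v) \sum_y adj x y =
     \sum_(x | x != v) adj v x + \sum_(x | x != v) \sum_(y | y != v) adj x y)%N.
    rewrite -big_split; apply: eq_bigr => x _ /=.
    by rewrite (bigD1 v) //= adj_sym.
  have -> : (\sum_(x | x != v) adj v x = deg v)%N.
    by rewrite /deg [RHS](bigD1 v) //= adj_irr.
  by rewrite -/(deg v) mul2n -addnn addnA addnC.
have degv : (deg v <= B + 1 + codeg u v)%N.
  have -> : B = (\sum_y b y)%N by rewrite [RHS](bigD1 v) //= /b adj_irr.
  have -> : 1%N = (\sum_(y : G) (y == u))%N.
    by rewrite (bigD1 u) //= eqxx big1 // => y /negbTE ->.
  rewrite -!big_split; apply: leq_sum => y _ /=; rewrite /b.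
  by case: (adj v y); case: (y == u); case: (adj u y).
have hB : (\sum_(x | x != v) \sum_(y | y != v) adj x y + 2 * B <=
   \sum_(x | x != v) \sum_(y | y != v)
    ((x != y) && [|| adj x y, (x == u) && adj v y | (y == u) && adj v x]))%N.
  have B1 : B = (\sum_(x | x != v) \sum_(y | y != v) ((x == u) && b y))%N.
    rewrite [RHS](bigD1 u) //= [X in (_ + X)%N]big1 ?addn0.
      by apply: eq_bigr => y _; rewrite eqxx.
    by move=> x /andP[_ /negbTE ->]; rewrite big1.
  have B2 : B = (\sum_(x | x != v) \sum_(y | y != v) ((y == u) && b x))%N.
    by rewrite exchange_big.
  rewrite mul2n -addnn {1}B1 B2 -!big_split; apply: leq_sum => x _.
  rewrite -!big_split; apply: leq_sum => y _ /=; rewrite /b.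
  case: (eqVneq x y) => [->|ne] /=.
    by rewrite adj_irr; case: (y == u); rewrite ?andbF.
  move: ne; case: (eqVneq x u) => [->|xu]; case: (eqVneq y u) => [->|yu] //= _;
    rewrite ?eqxx //.
  - by case: (adj v y); case: (adj u y).
  - by rewrite (adj_sym u x); case: (adj v x); case: (adj x u).
  - by case: (adj x y).
rewrite -/(arcs _); lia.
Qed.
Definition clique_adj n : rel 'I_n := fun x y => x != y.

Fact clique_adj_sym n : symmetric (@clique_adj n).
Proof. by move=> x y; rewrite /clique_adj eq_sym. Qed.

Fact clique_adj_irr n : irreflexive (@clique_adj n).
Proof. by move=> x; rewrite /clique_adj eqxx. Qed.

Definition clique n : sgraph :=
  SGraph (@clique_adj_sym n) (@clique_adj_irr n).

Lemma has_model_clique (H : sgraph) : has_model H (clique #|H|).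
Proof.
apply: (@has_model_embedding H (clique #|H|) (@enum_rank H)).
  exact: enum_rank_inj.
move=> x y xy; rewrite /= /clique_adj (inj_eq enum_rank_inj).
by apply: contraTneq xy => ->; rewrite adj_irr.
Qed.

(** The vertex x, adjacent to everything in its neighbourhood, is a branch set
    of its own for the additional vertex of the clique. *)
Lemma has_model_clique_cone (G : sgraph) (x : G) n :
  has_model (clique n) (induced_subgraph [set y | adj x y]%SET) ->
  has_model (clique n.+1) G.
Proof.
set N := [set y | adj x y]%SET => -[phi mphi].
pose Gx := induced_subgraph N.
have Nx (y : Gx) : adj x (val y) by have := valP y; rewrite inE.
pose psi (y : G) : option (clique n.+1) :=
  if y == x then Some ord0
  else obind (fun z : Gx => omap (lift ord0) (phi z)) (insub y).
have psix : psi x = Some ord0 by rewrite /psi eqxx.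
have psiN (y : Gx) : psi (val y) = omap (lift ord0) (phi y).
  rewrite /psi valK /=; case: eqP => // e.
  by have := Nx y; rewrite [val y]e adj_irr.
have psi0 y : psi y = Some ord0 -> y = x.
  rewrite /psi; case: eqP => // _; case: insubP => //= z _ _.
  by case: (phi z).
have psiS y i : psi y = Some (lift ord0 i) ->
    exists2 z : Gx, val z = y & phi z = Some i.
  rewrite /psi; case: eqP => // _; case: insubP => //= z _ <-.
  case e: (phi z) => [j|] //= /Some_inj/lift_inj <-; exists z => //.
exists psi; split.
- move=> i; case: (unliftP ord0 i) => [j|] ->; last by exists x.
  by have [y ey] := branch_inhabited mphi j; exists (val y); rewrite psiN ey.
- move=> y z i; case: (unliftP ord0 i) => [j|] ->; last first.
    by move=> /psi0 -> /psi0 ->; rewrite connect0.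
  move=> /psiS[y' <- ey'] /psiS[z' <- ez'].
  have /connectP[p] := branch_connected mphi ey' ez'.
  elim: p y' {ey'} => [|b p IH] a /=; first by move=> _ ->; rewrite connect0.
  move=> /andP[/andP[/andP[ab _] /eqP e] pth] lst.
  apply: (connect_trans (y := val b)); last exact: IH.
  by apply: connect1; rewrite /inner /= ab !psiN e eqxx.
- move=> i j; case: (unliftP ord0 i) => [i'|] ->;
    case: (unliftP ord0 j) => [j'|] ->.
  + rewrite /= /clique_adj (inj_eq lift_inj) => ij.
    have [y [z [ey ez /andP[yz _]]]] := branch_adj mphi ij.
    by exists (val y), (val z); rewrite !psiN ey ez.
  + move=> _; have [y ey] := branch_inhabited mphi i'.
    by exists (val y), x; rewrite psiN ey adj_sym Nx.
  + move=> _; have [y ey] := branch_inhabited mphi j'.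
    by exists x, (val y); rewrite psiN ey Nx.
  + by rewrite adj_irr.
Qed.

(** By induction on n, then on the number of vertices. Contracting an edge with
    at most c common neighbours loses at most 2c + 2 arcs and one vertex, so
    keeps the graph dense. If there is no such edge, every vertex of the
    neighbourhood N of a vertex x has more than c neighbours in N, so N is
    dense enough to contain the smaller clique, to which x is added. *)
Lemma dense_has_clique n : exists c, forall G : sgraph,
  (c * #|G| < arcs G)%N -> has_model (clique n) G.
Proof.
elim: n => [|n [c IH]].
  exists 0%N => G _; exists (fun=> None); split=> //; by case.
exists (2 * c + 2)%N => G.
have [m] := ubnP #|G|; elim: m => // m IHm in G *; rewrite ltnS => leGm dense.
have [[u [v [uv sparse]]]|locally_dense] := pselect (exists u v : G,
    adj u v /\ (codeg u v <= c)%N).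
  have cardG : #|Defs.contract u v|.+1 = #|G|.
    rewrite card_sig; apply/eqP; rewrite -(cardC (pred1 v)) card1 add1n eqSS.
    by apply/eqP; apply: eq_card => x; rewrite !inE.
  apply: has_model_trans (has_model_contract uv) _; apply: IHm.
    by rewrite cardG.
  by have := arcs_contract uv; move: dense; rewrite -cardG; nia.
have [x [y xy]] : exists x y : G, adj x y.
  apply: contrapT => none; move: dense; rewrite /arcs big1 ?ltn0 // => x _.
  by rewrite big1 // => y _; case xy: adj => //; case: none; exists x, y.
apply: (has_model_clique_cone (x := x)); apply: IH.
set N := [set y | adj x y]%SET.
have cN : #|induced_subgraph N| = #|N| by rewrite card_sig; apply: eq_card.
have N0 : (0 < #|N|)%N by apply/card_gt0P; exists y; rewrite inE.
have : (#|N| * c.+1 <= arcs (induced_subgraph N))%N.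
  rewrite arcs_induced -sum_nat_const; apply: leq_sum => a.
  rewrite inE => xa; rewrite ltnNge; apply/negP => le.
  apply: locally_dense; exists x, a; split => //; apply: leq_trans le.
  rewrite [leqRHS]big_mkcond; apply: leq_sum => z _; rewrite inE.
  by case: (adj x z).
by rewrite cN; nia.
Qed.

Lemma arcs_linear (A : gclass) : minor_closed A ->
  (exists H, excluded_minors A H) ->
  exists c, forall G, A G -> (arcs G <= c * #|G|)%N.
Proof.
move=> cA [H [nAH _]]; have [c dense] := dense_has_clique #|H|.
exists c => G AG.
rewrite leqNgt; apply/negP => /dense KG; apply: nAH.
apply: minor_closed_model cA _ AG.
exact: has_model_trans KG (has_model_clique H).
Qed.

Lemma exists_low_degree (G : sgraph) c :
  (0 < #|G|)%N -> (arcs G <= c * #|G|)%N -> exists v : G, (deg v <= c)%N.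
Proof.
move=> G0 le; apply: contrapT => high.
suff : (#|G| * c.+1 <= arcs G)%N by nia.
rewrite -sum_nat_const; apply: leq_sum => v _.
by rewrite ltnNge; apply/negP => ?; apply: high; exists v.
Qed.

Lemma arcsE (G : sgraph) : arcs G = (2 * #|edges G|)%N.
Proof.
rewrite /arcs pair_bigA /=.
have -> : (\sum_(p : G * G) adj p.1 p.2 =
    \sum_(p in [set p : G * G | adj p.1 p.2]%SET) 1)%N.
  by rewrite [RHS]big_mkcond; apply: eq_bigr => p _; rewrite inE; case: adj.
rewrite (partition_big_imset (fun p : G * G => [set p.1; p.2]%SET)) -/(edges G).
rewrite mulnC -sum_nat_const; apply: eq_bigr => E /imsetP[[x y]].
rewrite inE /= => xy ->; have xNy : x != y.
  by apply: contraTneq xy => ->; rewrite adj_irr.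
rewrite sum1dep_card.
have -> : [set p | (p \in [set p0 : G * G | adj p0.1 p0.2]) &&
    ([set p.1; p.2] == [set x; y])]%SET = [set (x, y); (y, x)]%SET.
  apply/setP => -[a b]; rewrite !inE /= !xpair_eqE; apply/andP/orP.
    case=> ab /eqP/setP e; have aNb : a != b.
      by apply: contraTneq ab => ->; rewrite adj_irr.
    have := e a; have := e b; rewrite !inE !eqxx /= orbT.
    move: aNb => /[swap] /esym/orP[]/eqP -> /[swap] /esym/orP[]/eqP ->;
      rewrite ?eqxx //; by [left|right].
  case=> /andP[/eqP -> /eqP ->]; first by rewrite xy.
  by rewrite adj_sym xy finset.setUC.
by rewrite cards2 xpair_eqE (negbTE xNy).
Qed.
(** * Edge-maximal graphs in an addable class *)
Lemma edge_maximalP (A : gclass) (G : sgraph) : minor_closed A ->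
  edge_maximal (excluded_minors A) G <->
  A G /\ forall u v : G, u != v -> A (add_edge u v) -> adj u v.
Proof.
move=> cA; have freeP := fun K => @excluded_freeP A K cA.
split=> -[freeG maxG]; split.
- exact/freeP.
- move=> u v uv Auv; apply: contrapT => /negP nuv.
  by apply: (maxG u v uv nuv); apply/freeP.
- exact/freeP.
- by move=> u v uv nuv /freeP/(maxG u v uv); rewrite (negbTE nuv).
Qed.

Lemma adj_add_edge (G : sgraph) (u v x y : G) : @adj (add_edge u v) x y =
  adj x y || (x != y) && ((x == u) && (y == v) || (x == v) && (y == u)).
Proof. by []. Qed.

Lemma arcs_add_edge (G : sgraph) (u v : G) :
  u != v -> ~~ adj u v -> (arcs G < arcs (add_edge u v))%N.
Proof.
move=> uv nuv; have hom (x y : G) : @adj G x y -> @adj (add_edge u v) x y.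
  by rewrite adj_add_edge => ->.
have [|le eq] := @arcs_le_of_hom G (add_edge u v) id _ hom; first by exists id.
rewrite ltn_neqAle le andbT; apply/eqP => /eq /(_ u v).
by rewrite (negbTE nuv) adj_add_edge uv !eqxx orbT.
Qed.

(** The extension is given as a relation, so that it has literally the same
    vertices as G. *)
Lemma edge_maximal_extension (A : gclass) (G : sgraph) : minor_closed A ->
  A G -> exists (r : rel G) (rs : symmetric r) (ri : irreflexive r),
    subrel (@adj G) r /\ edge_maximal (excluded_minors A) (SGraph rs ri).
Proof.
move=> cA; have [n] := ubnP (#|G| ^ 2 - arcs G)%N.
elim: n => // n IH in G *; rewrite ltnS => leGn AG.
have [maxG|] := pselect (forall u v : G, u != v -> A (add_edge u v) -> adj u v).
  exists (@adj G), (@adj_sym G), (@adj_irr G); split=> //.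
  by case: G AG maxG {leGn} => T a s i AG maxG; apply/edge_maximalP.
move=> /existsNP[u] /existsNP[v] /not_implyP[uv] /not_implyP[Auv] /negP nuv.
have lt := arcs_add_edge uv nuv; have le := arcs_le_sq (add_edge u v).
have card_add : #|add_edge u v| = #|G| by [].
have [|r [rs [ri [sub maxr]]]] := IH (add_edge u v) _ Auv.
  by rewrite card_add in le *; lia.
exists r, rs, ri; split=> // x y xy; apply: sub.
by rewrite adj_add_edge xy.
Qed.

(** An edge between two components could be added, by addability. *)
Lemma edge_maximal_connected (A : gclass) (G : sgraph) : minor_closed A ->
  addable A -> edge_maximal (excluded_minors A) G ->
  forall x y : G, connect adj x y.
Proof.
move=> cA [_ addA] /(edge_maximalP _ cA)[AG maxG] x y.
apply: contraT => nxy; case/negP: (nxy).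
apply: connect1; apply: maxG; last exact: addA.
by apply: contraNneq nxy => ->; rewrite connect0.
Qed.

(** An additional edge xy of G inside G1 would put G1 + xy in A. *)
Lemma edge_maximal_induced (A : gclass) (G1 G : sgraph) (i : G1 -> G) :
  minor_closed A -> edge_maximal (excluded_minors A) G1 -> A G ->
  injective i -> (forall x y, adj x y -> adj (i x) (i y)) ->
  forall x y, adj (i x) (i y) = adj x y.
Proof.
move=> cA /(edge_maximalP _ cA)[_ maxG1] AG injf homi x y.
apply/idP/idP => [ixy|]; last exact: homi.
have xNy : x != y by apply: contraTneq ixy => ->; rewrite adj_irr.
apply: maxG1 => //; apply: minor_closed_model cA _ AG.
apply: (@has_model_embedding (add_edge x y) G i) => // a b.
rewrite adj_add_edge => /orP[/homi//|].
by case/andP=> _ /orP[]/andP[/eqP -> /eqP ->] //; rewrite adj_sym.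
Qed.

(** Contracting the copy of G2 into x, along the edge xy, turns the edge v1v2
    into v1x. So G1 + v1x is a minor of G, hence in A, and as G1 is
    edge-maximal v1x is already an edge of G1. *)
Lemma cross_edge_neighbour (A : gclass) (G1 G2 G : sgraph)
    (i1 : G1 -> G) (i2 : G2 -> G) (v1 x : G1) (v2 y : G2) :
  minor_closed A -> edge_maximal (excluded_minors A) G1 -> A G ->
  (forall a b : G2, connect adj a b) ->
  injective i1 -> (forall a b, i1 a != i2 b) ->
  (forall a b, adj a b -> adj (i1 a) (i1 b)) ->
  (forall a b, adj a b -> adj (i2 a) (i2 b)) ->
  adj (i1 v1) (i2 v2) -> adj (i1 x) (i2 y) -> v1 != x -> adj v1 x.
Proof.
move=> cA /(edge_maximalP _ cA)[_ maxG1] AG conn2 inj1 disj hom1 hom2.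
move=> v12 xy v1x; apply: maxG1 => //; apply: minor_closed_model cA _ AG.
(* The branch set of x is x with the whole of G2. *)
pose phi (z : G) : option (add_edge v1 x) :=
  if [exists b, z == i2 b] then Some x else [pick a | i1 a == z].
have phi2 b : phi (i2 b) = Some x.
  by rewrite /phi; case: existsP => // -[]; exists b.
have phi1 a : phi (i1 a) = Some a.
  rewrite /phi; case: existsP => [[b]|_]; first by rewrite (negbTE (disj a b)).
  by case: pickP => [c /eqP/inj1 -> //|/(_ a)]; rewrite eqxx.
have phiP z a : phi z = Some a -> z = i1 a \/ (a = x /\ exists b, z = i2 b).
  rewrite /phi; case: existsP => [[b /eqP ->] [<-]|_].
    by right; split => //; exists b.
  by case: pickP => // c /eqP <- [->]; left.
have conn2G a b : connect (inner phi) (i2 a) (i2 b).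
  have /connectP[p] := conn2 a b; elim: p a => [|c p IH] a /=.
    by move=> _ ->; rewrite connect0.
  move=> /andP[ac pth] lst; apply: (connect_trans _ (IH c pth lst)).
  by apply: connect1; rewrite /inner /= hom2 // !phi2 eqxx.
have x_i2 b : connect (inner phi) (i1 x) (i2 b).
  apply: (connect_trans _ (conn2G y b)).
  by apply: connect1; rewrite /inner /= xy phi1 phi2 eqxx.
have i2_x b : connect (inner phi) (i2 b) (i1 x).
  apply: (connect_trans (conn2G b y)).
  by apply: connect1; rewrite /inner /= adj_sym xy phi1 phi2 eqxx.
exists phi; split.
- by move=> a; exists (i1 a).
- move=> z w a /phiP[->|[-> [b ->]]] /phiP[->|[e [b' ->]]] //.
  + by rewrite e.
- move=> a b; rewrite adj_add_edge => /orP[ab|].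
    by exists (i1 a), (i1 b); rewrite !phi1; split=> //; exact: hom1.
  case/andP=> _ /orP[]/andP[/eqP -> /eqP ->].
    by exists (i1 v1), (i2 v2); rewrite phi1 phi2.
  by exists (i2 v2), (i1 v1); rewrite phi1 phi2 adj_sym.
Qed.

Definition sum_adj (G1 G2 : sgraph) : rel (G1 + G2)%type := fun x y =>
  match x, y with
  | inl a, inl b => adj a b
  | inr a, inr b => adj a b
  | _, _ => false
  end.

Fact sum_adj_sym (G1 G2 : sgraph) : symmetric (@sum_adj G1 G2).
Proof. by move=> [x|x] [y|y] //=; rewrite adj_sym. Qed.

Fact sum_adj_irr (G1 G2 : sgraph) : irreflexive (@sum_adj G1 G2).
Proof. by move=> [x|x] /=; rewrite adj_irr. Qed.

Definition sum_graph (G1 G2 : sgraph) : sgraph :=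
  SGraph (@sum_adj_sym G1 G2) (@sum_adj_irr G1 G2).

Definition in_left {S T : Type} (x : S + T) : bool :=
  if x is inl _ then true else false.

Lemma connect_sum_graph (G1 G2 : sgraph) (x y : sum_graph G1 G2) :
  connect adj x y -> in_left x = in_left y.
Proof.
case/connectP=> p; elim: p x => [|z p IH] x /=; first by move=> _ ->.
by case/andP=> xz pth /(IH z pth) <-; case: x z xz {pth} => [x|x] [z|z].
Qed.

(** Each component of the sum is a subgraph of G1 or of G2. *)
Lemma sum_graph_closed (A : gclass) (G1 G2 : sgraph) :
  minor_closed A -> addable A -> A G1 -> A G2 -> A (sum_graph G1 G2).
Proof.
move=> cA [compA _] A1 A2; apply/compA => x.
have cxy (y : component x) : in_left (val y) = in_left x.
  by have := valP y; rewrite inE => /connect_sum_graph.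
have adjV (y z : component x) :
    adj y z -> @adj (sum_graph G1 G2) (val y) (val z).
  by case/andP.
case: x cxy adjV => v cxy adjV.
- apply: minor_closed_model cA _ A1.
  pose f (y : component (inl v : sum_graph G1 G2)) : G1 :=
    if val y is inl a then a else v.
  have fP y : val y = inl (f y) by rewrite /f; have := cxy y; case: (val y).
  apply: (@has_model_embedding _ G1 f) => [y z e|y z /adjV].
    by apply: val_inj; rewrite !fP e.
  by rewrite !fP.
- apply: minor_closed_model cA _ A2.
  pose f (y : component (inr v : sum_graph G1 G2)) : G2 :=
    if val y is inr a then a else v.
  have fP y : val y = inr (f y) by rewrite /f; have := cxy y; case: (val y).
  apply: (@has_model_embedding _ G2 f) => [y z e|y z /adjV].
    by apply: val_inj; rewrite !fP e.
  by rewrite !fP.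
Qed.

Lemma sum_closed_nbhd (G : sgraph) (v : G) :
  (\sum_(x : G) ((v == x) || adj v x) = (deg v).+1)%N.
Proof.
rewrite (bigD1 v) //= eqxx add1n; congr _.+1.
rewrite /deg [RHS](bigD1 v) //= adj_irr add0n.
by apply: eq_bigr => x; rewrite eq_sym => /negbTE ->.
Qed.

(** G extends the disjoint union with the edge v1v2; by
    [cross_edge_neighbour], applied on both sides, its edges between the two
    parts lie between the closed neighbourhoods of v1 and v2. *)
Lemma edge_maximal_join (A : gclass) (G1 G2 : sgraph) (v1 : G1) (v2 : G2) :
  minor_closed A -> addable A ->
  edge_maximal (excluded_minors A) G1 -> edge_maximal (excluded_minors A) G2 ->
  exists G : sgraph, [/\ edge_maximal (excluded_minors A) G,
    #|G| = (#|G1| + #|G2|)%N,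
    (arcs G1 + arcs G2 <= arcs G)%N &
    (arcs G <= arcs G1 + arcs G2 + 2 * ((deg v1).+1 * (deg v2).+1))%N].
Proof.
move=> cA addA max1 max2.
have [A1 _] := (edge_maximalP _ cA).1 max1.
have [A2 _] := (edge_maximalP _ cA).1 max2.
have conn1 := edge_maximal_connected cA addA max1.
have conn2 := edge_maximal_connected cA addA max2.
pose S := sum_graph G1 G2.
have AJ : A (@add_edge S (inl v1) (inr v2)).
  apply: addA.2; first exact: sum_graph_closed.
  by apply/negP => /connect_sum_graph.
have [r [rs [ri [sub maxr]]]] := edge_maximal_extension cA AJ.
pose G := SGraph rs ri; have [AG _] := (edge_maximalP _ cA).1 maxr.
pose i1 : G1 -> G := inl; pose i2 : G2 -> G := inr.
have hom1 a b : adj a b -> @adj G (inl a) (inl b).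
  by move=> ab; apply: sub; rewrite adj_add_edge [adj _ _]/= ab.
have hom2 a b : adj a b -> @adj G (inr a) (inr b).
  by move=> ab; apply: sub; rewrite adj_add_edge [adj _ _]/= ab.
have v12 : @adj G (inl v1) (inr v2).
  by apply: sub; rewrite adj_add_edge !eqxx.
have inj1 : injective i1 by move=> x y [].
have inj2 : injective i2 by move=> x y [].
have E1 := edge_maximal_induced cA max1 AG inj1 hom1.
have E2 := edge_maximal_induced cA max2 AG inj2 hom2.
have cross x y : @adj G (inl x) (inr y) ->
    ((v1 == x) || adj v1 x) && ((v2 == y) || adj v2 y).
  move=> xy; apply/andP; split.
    case: eqVneq => //= v1x.
    exact: (cross_edge_neighbour (i1 := i1) (i2 := i2) cA max1 AG conn2 inj1
      (fun _ _ => isT) hom1 hom2 v12 xy v1x).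
  case: eqVneq => //= v2y; rewrite adj_sym in xy; rewrite adj_sym in v12.
  exact: (cross_edge_neighbour (i1 := i2) (i2 := i1) cA max2 AG conn1 inj2
    (fun _ _ => isT) hom2 hom1 v12 xy v2y).
pose X := (\sum_(x : G1) \sum_(y : G2) @adj G (inl x) (inr y))%N.
have leX : (X <= (deg v1).+1 * (deg v2).+1)%N.
  rewrite -!sum_closed_nbhd big_distrlr /=; apply: leq_sum => x _.
  apply: leq_sum => y _; have := cross x y.
  by case: (@adj G _ _) => [/(_ isT)/andP[-> ->]|].
have arcsG : arcs G = (arcs G1 + arcs G2 + 2 * X)%N.
  rewrite [LHS]/arcs big_sumType /=.
  have -> : (\sum_(x : G1) \sum_(y : G) @adj G (inl x) y = arcs G1 + X)%N.
    rewrite /arcs /X -big_split; apply: eq_bigr => x _; rewrite big_sumType /=.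
    by congr addn; apply: eq_bigr => y _; rewrite -E1.
  have -> : (\sum_(x : G2) \sum_(y : G) @adj G (inr x) y = X + arcs G2)%N.
    rewrite /arcs /X [Y in (Y + _)%N]exchange_big -big_split.
    apply: eq_bigr => x _; rewrite big_sumType /=.
    congr addn; apply: eq_bigr => y _; last by rewrite -E2.
    by congr nat_of_bool; exact: rs.
  lia.
exists G; split=> //; first by rewrite card_sum.
- by rewrite arcsG leq_addr.
- by rewrite arcsG leq_add2l leq_mul2l leX orbT.
Qed.
(** * Numbers of edges of edge-maximal graphs *)

(** Excluded minors have an edge, hence so does any graph containing one. *)
Lemma edgeless_in_class (A : gclass) (G : sgraph) :
  suitable (excluded_minors A) -> (forall x y : G, ~~ adj x y) -> A G.
Proof.
move=> [_ edgeH] noarc; apply: contrapT => /exists_excluded[H exH [phi mphi]].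
have [x [y xy]] := edgeH H exH.
by have [a [b [_ _ ab]]] := branch_adj mphi xy; have := noarc a b; rewrite ab.
Qed.

Lemma edge_counts_nonempty (A : gclass) n :
  minor_closed A -> suitable (excluded_minors A) ->
  exists m, edge_counts (excluded_minors A) n m.
Proof.
move=> cA suit.
pose G0 := @SGraph 'I_n (fun _ _ => false) (fun _ _ => erefl) (fun _ => erefl).
have [r [rs [ri [_ maxr]]]] :=
  edge_maximal_extension cA (edgeless_in_class (G := G0) suit (fun _ _ => isT)).
by exists #|edges (SGraph rs ri)|, (SGraph rs ri); rewrite card_ord.
Qed.

Lemma min_natP (E : set nat) : (exists m, E m) ->
  E (min_nat E) /\ forall k, E k -> (min_nat E <= k)%N.
Proof.
move=> [m Em]; rewrite /min_nat; case: xgetP => [k -> //|none]; exfalso.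
elim/ltn_ind: m Em => m IH Em; apply: (none m); split=> // k Ek.
by rewrite leqNgt; apply/negP => /IH.
Qed.

Lemma max_natP (E : set nat) b : (exists m, E m) ->
  (forall m, E m -> (m <= b)%N) ->
  E (max_nat E) /\ forall k, E k -> (k <= max_nat E)%N.
Proof.
move=> [m Em] leb; rewrite /max_nat; case: xgetP => [k -> //|none]; exfalso.
have [n] := ubnP (b - m)%N; elim: n => // n IH in m Em *; rewrite ltnS => len.
apply: (none m); split=> // k Ek; rewrite leqNgt; apply/negP => mk.
by apply: (IH k Ek); have := leb k Ek; lia.
Qed.

Lemma edge_counts_le (A : gclass) c n m : minor_closed A ->
  (forall G, A G -> (arcs G <= c * #|G|)%N) ->
  edge_counts (excluded_minors A) n m -> (m <= c * n)%N.
Proof.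
move=> cA lin [G [<- /(edge_maximalP _ cA)[AG _] <-]].
by have := lin G AG; rewrite arcsE; lia.
Qed.

Lemma edge_counts_join (A : gclass) c n1 n2 m1 m2 :
  minor_closed A -> addable A ->
  (forall G, A G -> (arcs G <= c * #|G|)%N) -> (0 < n1)%N -> (0 < n2)%N ->
  edge_counts (excluded_minors A) n1 m1 ->
  edge_counts (excluded_minors A) n2 m2 ->
  exists m, [/\ edge_counts (excluded_minors A) (n1 + n2) m,
    (m1 + m2 <= m)%N & (m <= m1 + m2 + c.+1 ^ 2)%N].
Proof.
move=> cA addA lin n10 n20 [G1 [e1 max1 <-]] [G2 [e2 max2 <-]].
have [A1 _] := (edge_maximalP _ cA).1 max1.
have [A2 _] := (edge_maximalP _ cA).1 max2.
have [|v1 d1] := exists_low_degree _ (lin _ A1); first by rewrite e1.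
have [|v2 d2] := exists_low_degree _ (lin _ A2); first by rewrite e2.
have [G [maxG cardG]] := edge_maximal_join v1 v2 cA addA max1 max2.
have dd : ((deg v1).+1 * (deg v2).+1 <= c.+1 ^ 2)%N by rewrite -mulnn leq_mul.
rewrite !arcsE => lo hi; exists #|edges G|; split; [|lia|lia].
by exists G; rewrite cardG e1 e2.
Qed.

(** * The limit *)

Local Open Scope classical_set_scope.
Local Open Scope ring_scope.

(** Fekete's lemma with a defect K: f = g - K is superadditive, and the limit is
    the supremum of f(n)/n. *)
Lemma superadditive_cvg (R : realType) (g : nat -> R) (K C : R) :
  0 <= K -> (forall n, 0 <= g n <= C * n%:R) ->
  (forall m n, (0 < m)%N -> (0 < n)%N -> g m + g n - K <= g (m + n)%N) ->
  exists L : R, (fun n : nat => g n / n%:R) @ \oo --> L.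
Proof.
move=> K0 bnd sup_add; pose f n := g n - K.
pose E : set R := [set x | exists2 n, (0 < n)%N & x = f n / n%:R].
have E_ub : has_ubound E.
  exists C => _ [n n0 ->]; rewrite ler_pdivrMr ?ltr0n //.
  by rewrite lerBlDr; have /andP[_ /le_trans->//] := bnd n; rewrite lerDl.
have E_sup : has_sup E by split=> //; exists (f 1%N / 1%:R), 1%N.
(* Joining q blocks of size m, each at the cost K, to a rest r (where
   0 <= g r). *)
have iterate m q r : (0 < m)%N -> q%:R * f m <= g (q * m + r)%N.
  move=> m0; elim: q => [|q IH].
    by rewrite mul0r mul0n; case/andP: (bnd r).
  have [z|pos] := posnP (q * m + r)%N.
    have -> : (q.+1 * m + r = m)%N by rewrite mulSn -addnA z addn0.
    have -> : q = 0%N by move: z; nia.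
    by rewrite mul1r /f lerBlDr lerDl.
  rewrite mulSn -addnA; apply: le_trans (sup_add _ _ m0 pos).
  by rewrite -natr1 mulrDl mul1r /f in IH *; lra.
exists (sup E); apply/cvgrPdist_le => e e0.
have e20 : 0 < e / 2 by rewrite divr_gt0.
have [_ [m m0 ->] ltm] := sup_adherent e20 E_sup.
pose D := K + `|f m|; have D0 : 0 <= D by rewrite addr_ge0.
(* This bound makes D / n at most e / 2, where D accounts both for the defect
   K and for the remainder of n modulo m. *)
exists (Num.bound (D / (e / 2))).+1 => // n /= leNn.
have n0 : (0 < n)%N by apply: leq_trans leNn.
have n0R : 0 < n%:R :> R by rewrite ltr0n.
have Dn : D / n%:R <= e / 2.
  rewrite ler_pdivrMr // mulrC -ler_pdivrMr //.
  apply: ltW; apply: lt_le_trans (archi_boundP (divr_ge0 D0 (ltW e20))) _.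
  by rewrite ler_nat ltnW.
have upper : f n / n%:R <= sup E by apply: ub_le_sup => //; exists n.
have lower : f m / m%:R - `|f m| / n%:R <= g n / n%:R.
  rewrite ler_pdivlMr // mulrBl divfK ?gt_eqF //.
  have := iterate m (n %/ m)%N (n %% m)%N m0; rewrite -divn_eq.
  apply: le_trans; rewrite {1}(divn_eq n m) natrD natrM.
  have m0R : 0 < m%:R :> R by rewrite ltr0n.
  have -> : f m / m%:R * ((n %/ m)%:R * m%:R + (n %% m)%:R) =
      (n %/ m)%:R * f m + f m * ((n %% m)%:R / m%:R).
    by field; rewrite gt_eqF.
  rewrite -addrA gerDl subr_le0; apply: le_trans (ler_norm _) _.
  rewrite normrM ler_piMr // ger0_norm ?divr_ge0 // ler_pdivrMr // mul1r.
  by rewrite ler_nat ltnW // ltn_mod.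
have eqD : D / n%:R = K / n%:R + `|f m| / n%:R by rewrite /D mulrDl.
have K_n : 0 <= K / n%:R by rewrite divr_ge0.
have fm_n : 0 <= `|f m| / n%:R by rewrite divr_ge0.
have fn : f n / n%:R = g n / n%:R - K / n%:R by rewrite /f mulrBl.
rewrite ler_distl; apply/andP; split; lra.
Qed.

Theorem theorem4 (R : realType) (A : gclass)
    (hadd : addable A) (hminor : minor_closed A)
    (hsuit : suitable (excluded_minors A)) :
  (fun n : nat => gap R (excluded_minors A) n / n%:R) @ \oo
    --> limp R (excluded_minors A).
Proof.
set Hs := excluded_minors A.
have [c lin] := arcs_linear hminor hsuit.1.
have bound n m := @edge_counts_le A c n m hminor lin.
have nonempty n := edge_counts_nonempty n hminor hsuit.
have minP n := min_natP (nonempty n).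
have maxP n := max_natP (nonempty n) (bound n).
have [|n|m n m0 n0|L cvgL] :=
    @superadditive_cvg R (gap R Hs) (c.+1 ^ 2)%:R c%:R; first exact: ler0n.
- have [Emin min_le] := minP n; have [Emax _] := maxP n.
  rewrite /gap subr_ge0 ler_nat min_le //= lerBlDr -natrM -natrD ler_nat.
  by apply: leq_trans (bound n _ Emax) _; exact: leq_addr.
- have [M [EM leM _]] :=
    edge_counts_join hminor hadd lin m0 n0 (maxP m).1 (maxP n).1.
  have [N [EN _ leN]] :=
    edge_counts_join hminor hadd lin m0 n0 (minP m).1 (minP n).1.
  have hi := leq_trans leM ((maxP (m + n)%N).2 _ EM).
  have lo := leq_trans ((minP (m + n)%N).2 _ EN) leN.
  move: hi lo; rewrite -!(ler_nat R) !natrD /gap -/Hs; lra.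
by rewrite /limp -/Hs (cvg_limn_inf_sup cvgL).
Qed.
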